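(* Let $d\in\{1,2,3,7,11\}$, let $K=\mathbb{Q}(\sqrt{-d})$ and let $\mathcal{O}_d$ be its ring of integers. Let $\Delta$ be a positive integer which is not of the form $N(\beta)=\beta\bar\beta$ for any $\beta\in\mathcal{O}_d$. For odd $k\ge 1$ define $H_{k,\Delta}:\mathbb{C}\to\mathbb{R}$ by $$H_{k,\Delta}(z)=\sum_{\substack{(a,b,c)\in\mathbb{Z}\times\mathcal{O}_d\times\mathbb{Z}\\ N(b)-ac=\Delta,\ a<0}}\max\left(0,\left(a|z|^2+bz+\bar b\bar z+c\right)^k\right),$$ and put $\alpha_{k,\Delta}=H_{k,\Delta}(0)$. Then: (1) $H_{1,\Delta}(z)=\alpha_{1,\Delta}$ for all $z\in\mathbb{C}$; (2) if $d\in\{1,3,7\}$, then $H_{3,\Delta}(z)=\alpha_{3,\Delta}$ for all $z\in\mathbb{C}$; (3) if $d=3$, then $H_{5,\Delta}(z)=\alpha_{5,\Delta}$ for all $z\in\mathbb{C}$.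
   Context: $N(b)=b\bar b$ is the norm on $K$. Explicitly $\alpha_{k,\Delta}=\sum_{N(b)-ac=\Delta,\ a<0<c}c^k=\sum_{b\in\mathcal{O}_d,\ N(b)<\Delta}\sigma_k(\Delta-N(b))$, where $\sigma_k$ is the sum of $k$-th powers of divisors. *)

(* Defs.v *)
From HB Require Import structures.
From mathcomp Require Import all_boot all_order all_algebra.
From mathcomp Require Import complex.
From mathcomp Require Import classical_sets reals ereal esum.
Unset Printing Implicit Defensive.
Import Order.TTheory GRing.Theory Num.Theory.
Local Open Scope ring_scope.

(* The generator of the ring of integers O_d of K = Q(sqrt(-d)), as an
   element of C = R[i]:  O_d = Z[omega_d] with
   omega_d = (1 + sqrt(-d))/2 if d = 3 mod 4, and omega_d = sqrt(-d) otherwise. *)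
Definition omega (R : realType) (d : nat) : R[i] :=
  if (d %% 4 == 3)%N then Complex (2^-1) (Num.sqrt (d%:R) / 2)
  else Complex 0 (Num.sqrt (d%:R)).

(* An element of O_d is represented by its coordinates (x, y) in the
   Z-basis (1, omega_d); this is its embedding into C. *)
Definition embO (R : realType) (d : nat) (b : int * int) : R[i] :=
  b.1%:~R + b.2%:~R * omega R d.

Definition normC (R : realType) (w : R[i]) : R[i] := w * conjc w.

Definition Hindex (R : realType) (d : nat) (Delta : nat) :
    set (int * (int * int) * int) :=
  [set t | (normC R (embO R d t.1.2) - (t.1.1 * t.2)%:~R = Delta%:R)
           /\ (t.1.1 < 0)%R].

Definition Qform (R : realType) (d : nat) (t : int * (int * int) * int)
    (z : R[i]) : R[i] :=
  let b := embO R d t.1.2 in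
  t.1.1%:~R * (z * conjc z) + b * z + conjc b * conjc z + t.2%:~R.

(* H_{k,Delta}(z) as a sum (in \bar R) of nonnegative terms
   max(0, (a|z|^2 + b z + conj b conj z + c)^k); the inner expression is
   real, and we take its real part. *)
Definition H (R : realType) (d k Delta : nat) (z : R[i]) : \bar R :=
  \esum_(t in Hindex R d Delta)
    (Num.max 0 ((complex.Re (Qform R d t z)) ^+ k))%:E.

Definition alpha (R : realType) (d k Delta : nat) : \bar R := H R d k Delta 0.

(* Main.v *)
(* Translations by O_d, b -> -b and b -> conj b permute the forms, and swapping a and c
   gives |z|^(2k) H(1/conj z) = H(z) + P(z), where P(z) is the finite sum of f(z)^k over
   the forms with c < 0 < a.  Since O_d is Euclidean, z can be translated into
   |z|^2 <= 15/16, where inversion lowers |a| for all but finitely many of the forms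
   positive at z; this bounds H.  The symmetries of P leave few free coefficients besides
   H(0) (|z|^(2k) - 1), and these vanish because the values of H along orbits of the
   extended Bianchi group must be consistent.  Then g = H - H(0) is bounded and satisfies
   |z|^(2k) g(1/conj z) = g(z), so sup |g| <= 15/16 sup |g|, that is g = 0. *)

Require Import Defs.
From HB Require Import structures.
From mathcomp Require Import all_boot all_order all_algebra.
From mathcomp Require Import complex.
From mathcomp Require Import classical_sets reals ereal esum.
From mathcomp Require Import finmap functions cardinality fsbigop ring lra zify.
Import Order.TTheory GRing.Theory Num.Theory.
Local Open Scope ring_scope.

(** * Sums of nonnegative extended reals over arbitrary sets *)

Lemma cancel_set_bij (T U : Type) (P : set T) (Q : set U) (h : T -> U) (h' : U -> T) :
    (forall t, P t -> Q (h t)) -> (forall u, Q u -> P (h' u)) ->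
    cancel h h' -> cancel h' h -> set_bij P Q h.
Proof.
move=> hPQ hQP hK h'K; split=> [t Pt|t u _ _ /(can_inj hK)|u Qu] //.
  exact: hPQ.
by exists (h' u); [exact: hQP | rewrite h'K].
Qed.

Lemma esum_reindex_cancel (R : realType) (T U : choiceType) (P : set T) (Q : set U)
    (h : T -> U) (h' : U -> T) (a : U -> \bar R) (b : T -> \bar R) :
    (forall t, P t -> Q (h t)) -> (forall u, Q u -> P (h' u)) ->
    cancel h h' -> cancel h' h -> (forall t, P t -> a (h t) = b t) ->
  esum Q a = esum P b.
Proof.
move=> hPQ hQP hK h'K hab.
rewrite (@reindex_esum _ _ _ P Q h) //; first exact: eq_esum.
exact: cancel_set_bij hPQ hQP hK h'K.
Qed.

Lemma le_esum_set (R : realType) (T : choiceType) (P Q : set T) (a b : T -> \bar R) :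
    (forall t, Q t -> (0 <= b t)%E) -> (forall t, P t -> (0 < a t)%E -> Q t) ->
    (forall t, P t -> Q t -> (a t <= b t)%E) ->
  (esum P a <= esum Q b)%E.
Proof.
move=> b0 aQ ab; rewrite esum_mkcond [leRHS]esum_mkcond; apply: le_esum => t _.
case: ifPn => [/set_mem Pt|_]; last by case: ifPn => // /set_mem /b0.
case: ifPn => [/set_mem Qt|]; first exact: ab.
by rewrite leNgt; apply: contra => a0; apply/mem_set/aQ.
Qed.

(** One inequality holds for every positive factor and every nonnegative family; used with [r^-1] on
    the scaled family it gives the converse. *)
Lemma esumZl (R : realType) (T : choiceType) (P : set T) (r : R) (a : T -> \bar R) :
    0 <= r -> (forall t, (0 <= a t)%E) ->
  \esum_(t in P) (r%:E * a t)%E = (r%:E * esum P a)%E.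
Proof.
have le s (b : T -> \bar R) : 0 < s -> (forall t, (0 <= b t)%E) ->
    (\esum_(t in P) (s%:E * b t) <= s%:E * esum P b)%E.
  move=> s0 b0; apply: ge_ereal_sup => _ [X [finX XP] <-].
  by rewrite -ge0_mule_fsumr// lee_pmul2l// esum_ge//; exists X.
rewrite le_eqVlt => /predU1P[<- _|r0 a0].
  by rewrite mul0e esum1// => t _; rewrite mul0e.
apply/eqP; rewrite eq_le le//=.
have -> : esum P a = \esum_(t in P) (r^-1%:E * (r%:E * a t))%E.
  by apply: eq_esum => t _; rewrite muleA -EFinM mulVf ?gt_eqF// mul1e.
apply: (@le_trans _ _ (r%:E * (r^-1%:E * (\esum_(t in P) (r%:E * a t))))%E).
  rewrite lee_pmul2l// le ?invr_gt0// => t.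
  by rewrite mule_ge0// ?a0// lee_fin ltW.
by rewrite muleA -EFinM mulfV ?gt_eqF// mul1e.
Qed.

(** * Hermitian forms in real coordinates and their symmetries *)

Section HermitianForms.
Local Open Scope classical_set_scope.
(** Here omega = p + i q has trace [tau] and norm [nu], so that all five rings are treated at
    once. *)
Variables (R : realType) (tau nu : int) (p q : R) (Delta : nat).
Hypotheses (pE : 2 * p = tau%:~R) (qE : p ^+ 2 + q ^+ 2 = nu%:~R).

Local Notation form := (int * (int * int) * int)%type.

Definition qnorm (b : int * int) : int :=
  b.1 ^+ 2 + tau * b.1 * b.2 + nu * b.2 ^+ 2.

Definition reO (b : int * int) : R := b.1%:~R + b.2%:~R * p.
Definition imO (b : int * int) : R := b.2%:~R * q.

Definition hval (t : form) (x y : R) : R :=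
  t.1.1%:~R * (x ^+ 2 + y ^+ 2) + 2 * (reO t.1.2 * x - imO t.1.2 * y) + t.2%:~R.

Definition hterm k t x y : R := Num.max 0 (hval t x y ^+ k).

Definition forms : set form :=
  [set t | qnorm t.1.2 - t.1.1 * t.2 = Delta].

(** The predicate is [xpredT] for H itself and a bound on |a| for the truncated sums through which
    finiteness is proved; symmetries fixing a serve both. *)
Definition nforms (A : pred int) : set form :=
  [set t | forms t /\ (t.1.1 < 0) && A t.1.1].

Definition Hsum (A : pred int) k x y : \bar R :=
  \esum_(t in nforms A) (hterm k t x y)%:E.

Lemma hterm_ge0 k t x y : 0 <= hterm k t x y.
Proof. by rewrite /hterm le_max lexx. Qed.

Lemma intr_qnorm b : (qnorm b)%:~R = reO b ^+ 2 + imO b ^+ 2.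
Proof.
rewrite /qnorm /reO /imO !(rmorphD, rmorphM) /= -pE -qE; ring.
Qed.

(** The trace of the product b l, since omega^2 has trace tau^2 - 2 nu. *)
Definition trO (b l : int * int) : int :=
  2 * b.1 * l.1 + tau * (b.1 * l.2 + b.2 * l.1) + (tau ^+ 2 - 2 * nu) * b.2 * l.2.

(** Coefficients of f(z + l): b becomes b + a conj l, where conj l has coordinates (l.1 + tau l.2, -
    l.2). *)
Definition hshift (l : int * int) (t : form) : form :=
  (t.1.1, (t.1.2.1 + t.1.1 * (l.1 + tau * l.2), t.1.2.2 - t.1.1 * l.2),
   t.2 + trO t.1.2 l + t.1.1 * qnorm l).

Lemma hshiftK l : cancel (hshift l) (hshift (- l)).
Proof.
case: l => m n [[a [x y]] c]; rewrite /hshift /trO /qnorm /=.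
by congr (_, (_, _), _); ring.
Qed.

Lemma hshift_forms l t : forms t -> forms (hshift l t).
Proof.
case: l t => m n [[a [x y]] c]; rewrite /forms /hshift /trO /qnorm /= => <-; ring.
Qed.

Lemma hval_hshift l t x y : hval (hshift l t) x y = hval t (x + reO l) (y + imO l).
Proof.
case: l t => m n [[a [u v]] c]; rewrite /hval /hshift /qnorm /=.
rewrite /trO /reO /imO /= !(rmorphD, rmorphM, rmorphB, rmorphN) /= -pE -qE; ring.
Qed.

Lemma HsumD A k l x y : Hsum A k (x + reO l) (y + imO l) = Hsum A k x y.
Proof.
apply/esym/(@esum_reindex_cancel _ _ _ _ _ (hshift l) (hshift (- l))).
- by move=> t [ft at0]; split=> //; apply: hshift_forms.
- by move=> t [ft at0]; split=> //; apply: hshift_forms.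
- exact: hshiftK.
- by have := hshiftK (- l); rewrite opprK.
- by move=> t _; rewrite /hterm hval_hshift.
Qed.

Definition hopp (t : form) : form := (t.1.1, (- t.1.2.1, - t.1.2.2), t.2).
Definition hconj (t : form) : form :=
  (t.1.1, (t.1.2.1 + tau * t.1.2.2, - t.1.2.2), t.2).
Definition hswap (t : form) : form := (t.2, t.1.2, t.1.1).
Definition hneg (t : form) : form := (- t.1.1, (- t.1.2.1, - t.1.2.2), - t.2).

Lemma hoppK : involutive hopp.
Proof. by case=> [[a [x y]] c]; rewrite /hopp /= !opprK. Qed.
Lemma hconjK : involutive hconj.
Proof. by case=> [[a [x y]] c]; rewrite /hconj /=; congr (_, (_, _), _); ring. Qed.
Lemma hswapK : involutive hswap.
Proof. by case=> [[a [x y]] c]. Qed.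
Lemma hnegK : involutive hneg.
Proof. by case=> [[a [x y]] c]; rewrite /hneg /= !opprK. Qed.

Lemma forms_hopp t : forms t -> forms (hopp t).
Proof. by rewrite /forms /= /qnorm /= => <-; ring. Qed.
Lemma forms_hconj t : forms t -> forms (hconj t).
Proof. by rewrite /forms /= /qnorm /= => <-; ring. Qed.
Lemma forms_hswap t : forms t -> forms (hswap t).
Proof. by rewrite /forms /= /qnorm /= => <-; ring. Qed.
Lemma forms_hneg t : forms t -> forms (hneg t).
Proof. by rewrite /forms /= /qnorm /= => <-; ring. Qed.

Lemma hval_hopp t x y : hval (hopp t) x y = hval t (- x) (- y).
Proof. by rewrite /hval /reO /imO /= !rmorphN /=; ring. Qed.
Lemma hval_hconj t x y : hval (hconj t) x y = hval t x (- y).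
Proof. by rewrite /hval /reO /imO /= !(rmorphN, rmorphD, rmorphM) /= -pE; ring. Qed.
Lemma hval_hneg t x y : hval (hneg t) x y = - hval t x y.
Proof. by rewrite /hval /reO /imO /= !rmorphN /=; ring. Qed.
Lemma hval_hswap t x y : x ^+ 2 + y ^+ 2 != 0 ->
  hval (hswap t) x y =
  (x ^+ 2 + y ^+ 2) * hval t (x / (x ^+ 2 + y ^+ 2)) (y / (x ^+ 2 + y ^+ 2)).
Proof. by move=> X0; rewrite /hval /=; field. Qed.

Lemma HsumN A k x y : Hsum A k (- x) (- y) = Hsum A k x y.
Proof.
apply/esym/(@esum_reindex_cancel _ _ _ _ _ hopp hopp); try exact: hoppK.
- by move=> t [ft at0]; split=> //; apply: forms_hopp.
- by move=> t [ft at0]; split=> //; apply: forms_hopp.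
- by move=> t _; rewrite /hterm hval_hopp.
Qed.

Lemma Hsum_conj A k x y : Hsum A k x (- y) = Hsum A k x y.
Proof.
apply/esym/(@esum_reindex_cancel _ _ _ _ _ hconj hconj); try exact: hconjK.
- by move=> t [ft at0]; split=> //; apply: forms_hconj.
- by move=> t [ft at0]; split=> //; apply: forms_hconj.
- by move=> t _; rewrite /hterm hval_hconj.
Qed.

(** * The finite set of forms with c < 0 < a, and the inversion formula *)

Hypotheses (p_ge0 : 0 <= p) (p_le : p <= 2^-1) (q_gt0 : 0 < q).
Hypotheses (q2_ge : 3 / 4 <= q ^+ 2) (q2_le : q ^+ 2 <= 11 / 4).
Hypothesis DeltaP : forall b, qnorm b <> Delta.

Lemma qnorm_ge0 b : 0 <= qnorm b.
Proof. by rewrite -(ler0z R) intr_qnorm addr_ge0 ?sqr_ge0. Qed.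

Lemma qnorm_bound b (N : int) : qnorm b <= N -> `|b.1| <= 4 * N /\ `|b.2| <= 4 * N.
Proof.
rewrite -(ler_int R) intr_qnorm /reO /imO => bN.
(* An integer satisfies |u| <= u^2, so a crude bound on the square is enough. *)
have le_sqr (u : int) : (u%:~R ^+ 2 <= 4 * N%:~R :> R) -> `|u| <= 4 * N.
  rewrite -[4]/(4%:~R) -intrM expr2 -intrM ler_int; nia.
set u : R := b.1%:~R in bN *; set v : R := b.2%:~R in bN *.
have v2 : v ^+ 2 * (3 / 4) <= (v * q) ^+ 2 by rewrite exprMn ler_wpM2l ?sqr_ge0.
have vp : (v * p) ^+ 2 <= v ^+ 2 * 4^-1.
  rewrite exprMn ler_wpM2l ?sqr_ge0// (_ : 4^-1 = 2^-1 ^+ 2); last by field.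
  by rewrite lerXn2r// nnegrE invr_ge0.
have v0 := sqr_ge0 v; have uv := sqr_ge0 (u + v * p); have uv2 := sqr_ge0 (u + 2 * (v * p)).
split; apply: le_sqr; rewrite -/u -/v; [|lra].
have -> : u ^+ 2 = 2 * (u + v * p) ^+ 2 + 2 * (v * p) ^+ 2 - (u + 2 * (v * p)) ^+ 2 by ring.
lra.
Qed.

(** If a or c were 0, then Delta = N(b). This is where the assumption that Delta is not a norm
    enters. *)
Lemma forms_neq0 t : forms t -> t.1.1 != 0 /\ t.2 != 0.
Proof.
move=> ft; have := DeltaP t.1.2; move: ft; rewrite /forms /=.
by case: eqVneq => [->|_]; case: eqVneq => [->|_]; rewrite ?mul0r ?mulr0 ?subr0.
Qed.

Definition hbox (K : int) : set form :=
  [set t | [/\ `|t.1.1| <= K, `|t.1.2.1| <= K, `|t.1.2.2| <= K & `|t.2| <= K]].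

Lemma finite_hbox K : finite_set (hbox K).
Proof.
pose B := [set a : int | `|a| <= K].
have finB : finite_set B.
  pose s := iota 0 `|K|%N.+1.
  apply: (@sub_finite_set _ _ [set` [seq Posz i | i <- s] ++ [seq - Posz i | i <- s]]).
    move=> a; rewrite /B /mkset => aK; rewrite mem_cat; apply/orP.
    case: (lerP 0 a) => a0; [left|right]; apply/mapP; exists `|a|%N;
      rewrite ?mem_iota; lia.
  exact: finite_seq.
apply: (@sub_finite_set _ _ (B `*` (B `*` B) `*` B)); last by do !apply: finite_setX.
by move=> t [] *.
Qed.

Definition mforms : set form := [set t | forms t /\ (t.2 < 0) && (0 < t.1.1)].

(** When c < 0 < a, Delta = N(b) + |a| |c| bounds every coefficient. *)
Lemma finite_mforms : finite_set mforms.
Proof.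
apply: (@sub_finite_set _ _ (hbox (4 * Delta%:Z))); last exact: finite_hbox.
move=> [[a b] c] [] /=; rewrite /forms /= => ft /andP[c0 a0].
have b0 := qnorm_ge0 b; have [|b1 b2] := qnorm_bound b Delta; first by nia.
by split=> //=; nia.
Qed.

Definition hper k x y : R := \sum_(t <- fset_set mforms) hval t x y ^+ k.

(** For odd k the truncated terms of a form and of its negative differ by a polynomial in z, which
    makes [hper] a polynomial. *)
Lemma max_odd_exp k (u : R) : odd k ->
  Num.max 0 (u ^+ k) - Num.max 0 ((- u) ^+ k) = u ^+ k.
Proof.
move=> k1; rewrite exprNn -signr_odd k1 expr1 mulN1r.
have [v0|/ltW v0] := lerP 0 (u ^+ k).
  by rewrite (max_idPl _) ?oppr_le0// subr0.
by rewrite (max_idPr _) ?oppr_ge0// sub0r opprK.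
Qed.

Lemma max_odd_exp_le0 k (u : R) : odd k -> u <= 0 -> Num.max 0 (u ^+ k) = 0.
Proof. by move=> k1 u0; apply/max_idPl; rewrite exprn_odd_le0. Qed.

(* At [z = 0], where [x / 0 = 0], the power of [|z|^2] kills the right-hand side, and
   the left-hand side vanishes because [hswap t] has negative constant term. *)
Lemma hterm_hswap k t x y : odd k -> t.1.1 < 0 ->
  hterm k (hswap t) x y =
  (x ^+ 2 + y ^+ 2) ^+ k *
    hterm k t (x / (x ^+ 2 + y ^+ 2)) (y / (x ^+ 2 + y ^+ 2)).
Proof.
move=> k1 a0; have k0 : (0 < k)%N by case: k k1.
have X0 : 0 <= x ^+ 2 + y ^+ 2 by rewrite addr_ge0 ?sqr_ge0.
have [XE|X1] := eqVneq (x ^+ 2 + y ^+ 2) 0.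
  have [-> ->] : x = 0 /\ y = 0.
    by move/eqP: XE; rewrite paddr_eq0 ?sqr_ge0// !sqrf_eq0 => /andP[/eqP-> /eqP->].
  rewrite /hterm /hval /= !expr0n /= !addr0 !mulr0 subr0 mulr0 !add0r ?expr0n (gtn_eqF k0) mul0r.
  by rewrite max_odd_exp_le0// lerz0 ltW.
rewrite /hterm hval_hswap// exprMn -[in LHS](mulr0 ((x ^+ 2 + y ^+ 2) ^+ k)).
by rewrite maxr_pMr// exprn_ge0.
Qed.

(** The forms with a < 0 are split by the sign of c, and those with c < 0, which [hswap] produces,
    by the sign of a; the part with both negative is common. Forms with a < 0 < c are the negatives
    of [mforms]. Finiteness is not yet known, so the formula avoids subtraction. *)
Lemma Hsum_inv_fin k x y : odd k ->
  (Hsum xpredT k x y + (\sum_(t <- fset_set mforms) hterm k t x y)%:E =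
   ((x ^+ 2 + y ^+ 2) ^+ k)%:E *
     Hsum xpredT k (x / (x ^+ 2 + y ^+ 2)) (y / (x ^+ 2 + y ^+ 2)) +
   (\sum_(t <- fset_set mforms) hterm k (hneg t) x y)%:E)%E.
Proof.
move=> k1; pose T t := (hterm k t x y)%:E.
have T0 t : (0 <= T t)%E by rewrite lee_fin hterm_ge0.
pose nn : set form := [set t | forms t /\ (t.1.1 < 0) && (t.2 < 0)].
have mE (h : form -> form) : (\sum_(t <- fset_set mforms) hterm k (h t) x y)%:E =
    \esum_(t in mforms) T (h t).
  have fm := finite_mforms.
  by rewrite esum_fset// fsbig_finite//= sumEFin.
have HE : Hsum xpredT k x y = (esum nn T + \esum_(t in mforms) T (hneg t))%E.
  rewrite -[LHS]/(esum (nforms xpredT) T) 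
    (@esumID _ _ [set t : form | t.2 < 0] _ T (fun t _ => T0 t)).
  congr (_ + _)%E.
    apply: (congr1 (fun A => esum A T)); apply/seteqP; split=> t /=.
      by case=> -[ft /andP[a0 _]] c0; split=> //; rewrite a0.
    by case=> ft /andP[a0 c0]; split=> //; split=> //; rewrite a0.
  apply: (@esum_reindex_cancel _ _ _ _ _ hneg hneg) => //; try exact: hnegK.
    move=> t [ft /andP[c0 a0]]; split; first by split; [exact: forms_hneg|rewrite /= oppr_lt0 a0].
    by rewrite /= oppr_lt0; apply/negP; rewrite -leNgt ltW.
  move=> t [[ft /andP[a0 _]] /= /negP c0]; split; first exact: forms_hneg.
  have [_ c1] := forms_neq0 _ ft.
  by rewrite /= oppr_lt0 oppr_gt0 a0 lt_def c1 leNgt c0.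
have HI : (((x ^+ 2 + y ^+ 2) ^+ k)%:E *
     Hsum xpredT k (x / (x ^+ 2 + y ^+ 2)) (y / (x ^+ 2 + y ^+ 2)) =
     esum nn T + esum mforms T)%E.
  rewrite /Hsum -esumZl; last 2 first.
  - by rewrite exprn_ge0// addr_ge0 ?sqr_ge0.
  - by move=> t; rewrite lee_fin hterm_ge0.
  transitivity (esum [set t : form | forms t /\ t.2 < 0] T).
    apply/esym/(@esum_reindex_cancel _ _ _ _ _ hswap hswap) => //; try exact: hswapK.
    - by move=> t [ft /andP[a0 _]]; split=> //; exact: forms_hswap.
    - by move=> t [ft c0]; split; [exact: forms_hswap|rewrite /= c0].
    - by move=> t [ft /andP[a0 _]]; rewrite /T hterm_hswap.
  rewrite (@esumID _ _ [set t : form | t.1.1 < 0] _ T (fun t _ => T0 t)).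
  congr (_ + _)%E.
    apply: (congr1 (fun A => esum A T)); apply/seteqP; split=> t /=.
      by case=> -[ft c0] a0; split=> //; rewrite a0.
    by case=> ft /andP[a0 c0].
  apply: (congr1 (fun A => esum A T)); apply/seteqP; split=> t /=.
    case=> -[ft c0] /negP a0; split=> //; have [a1 _] := forms_neq0 _ ft.
    by rewrite c0 lt_def a1 leNgt a0.
  by case=> ft /andP[c0 a0]; split=> //; apply/negP; rewrite -leNgt ltW.
by rewrite HE HI (mE id) (mE hneg) addeAC.
Qed.

(** * Euclidean reduction and boundedness of H *)

Lemma floor_close (u : R) : exists n : int, (u + n%:~R) ^+ 2 <= 4^-1.
Proof.
exists (- Num.floor (u + 2^-1)); rewrite rmorphN /=.
have := floor_itv (u + 2^-1); rewrite intrD => /andP[]; nra.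
Qed.

(** The imaginary part is moved to within q/2 of 0, then the real part to within 1/2; as q^2 <= 11/4
    the total is at most 11/16 + 1/4. That this is below 1 drives both contraction arguments
    below. *)
Lemma euclidean x y : exists l, (x + reO l) ^+ 2 + (y + imO l) ^+ 2 <= 15 / 16.
Proof.
have [n yn] := floor_close (y / q); have [m xm] := floor_close (x + n%:~R * p).
exists (m, n); rewrite /reO /imO /=.
have -> : y + n%:~R * q = (y / q + n%:~R) * q by field; rewrite gt_eqF.
rewrite exprMn (_ : x + _ = x + n%:~R * p + m%:~R); last by ring.
have : (y / q + n%:~R) ^+ 2 * q ^+ 2 <= 4^-1 * (11 / 4) by rewrite ler_pM ?sqr_ge0.
lra.
Qed.

(** Completing the square: the left-hand side is |a z + conj b|^2. *)
Lemma hval_center t x y : forms t ->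
  (t.1.1%:~R * x + reO t.1.2) ^+ 2 + (t.1.1%:~R * y - imO t.1.2) ^+ 2 =
  t.1.1%:~R * hval t x y + Delta%:R.
Proof.
rewrite /forms /= => /(congr1 (fun n : int => n%:~R : R)).
rewrite rmorphB /= rmorphM /= intr_qnorm -pmulrn => <-; rewrite /hval; ring.
Qed.

Lemma hval_le t x y : forms t -> t.1.1 < 0 -> 0 < hval t x y -> hval t x y <= Delta%:R.
Proof.
move=> /(hval_center t x y) E a0 f0.
have : 0 <= t.1.1%:~R * hval t x y + Delta%:R by rewrite -E addr_ge0 ?sqr_ge0.
have : t.1.1%:~R <= -1 :> R by rewrite -(intrN _ 1) ler_int; lia.
nra.
Qed.

(** Positivity at z gives |a z + conj b|^2 <= Delta, and |a z| <= A, so N(b) is bounded; then |c| <=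
    |a c| = |N(b) - Delta|. *)
Lemma hval_box t x y (A : int) : 0 <= A -> x ^+ 2 + y ^+ 2 <= 15 / 16 ->
  forms t -> t.1.1 < 0 -> 0 < hval t x y -> `|t.1.1| <= A ->
  hbox (4 * (2 * Delta%:Z + 2 * A * A) + A) t.
Proof.
move=> A0 X1 ft a0 f0 aA.
have bN : qnorm t.1.2 <= 2 * Delta%:Z + 2 * A * A.
  have E := hval_center t x y ft.
  have a0R : t.1.1%:~R < 0 :> R by rewrite ltrz0.
  have aAR : t.1.1%:~R ^+ 2 <= A%:~R * A%:~R :> R.
    by rewrite expr2 -!intrM ler_int; nia.
  have af : t.1.1%:~R * hval t x y < 0 by rewrite nmulr_rlt0.
  rewrite -(ler_int R) intr_qnorm !(intrD, intrM).
  set a : R := t.1.1%:~R in E a0R aAR af *.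
  (* Parallelogram law for a z + conj b and a z. *)
  have -> : reO t.1.2 ^+ 2 + imO t.1.2 ^+ 2 =
      2 * ((a * x + reO t.1.2) ^+ 2 + (a * y - imO t.1.2) ^+ 2) +
      2 * (a ^+ 2 * (x ^+ 2 + y ^+ 2)) -
      (2 * a * x + reO t.1.2) ^+ 2 - (2 * a * y - imO t.1.2) ^+ 2 by ring.
  have : a ^+ 2 * (x ^+ 2 + y ^+ 2) <= A%:~R * A%:~R * 1.
    by rewrite ler_pM ?sqr_ge0 ?addr_ge0 ?sqr_ge0//; lra.
  have := sqr_ge0 (2 * a * x + reO t.1.2); have := sqr_ge0 (2 * a * y - imO t.1.2).
  rewrite E -pmulrn; lra.
have [b1 b2] := qnorm_bound _ _ bN; have b0 := qnorm_ge0 t.1.2.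
have c1 : `|t.2| <= `|t.1.1| * `|t.2| by rewrite ler_peMl//; lia.
have acE : t.1.1 * t.2 = qnorm t.1.2 - Delta%:Z by rewrite -[Delta%:Z]ft; ring.
move: c1; rewrite -normrM acE; move: b1 b2 bN b0; have : 0 <= A * A by rewrite mulr_ge0.
rewrite -[2 * A * A]mulrA; move: (A * A) (qnorm _) => AA N *.
by split=> /=; lia.
Qed.

(** Positivity forces z to lie close to -conj b / a, so N(b) / a^2 is hardly larger than 15/16,
    whereas |c| >= |a| would make it at least 1. *)
Lemma hval_far t x y : x ^+ 2 + y ^+ 2 <= 15 / 16 ->
  forms t -> t.1.1 < 0 -> 0 < hval t x y -> 32 * Delta%:Z < `|t.1.1| ->
  (t.2 < 0) && (`|t.2| < `|t.1.1|).
Proof.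
move=> X1 ft a0 f0 aD; have E := hval_center t x y ft.
have b0 := qnorm_ge0 t.1.2; have [_ c1] := forms_neq0 t ft.
have N : qnorm t.1.2 = Delta%:Z + t.1.1 * t.2 by rewrite -[Delta%:Z]ft; ring.
have c0 : t.2 < 0 by rewrite ltNge; apply/negP => c0; nia.
rewrite c0 /= ltNge; apply/negP => ca.
have aR : 32 * Delta%:R < - t.1.1%:~R :> R.
  by rewrite -intrN (pmulrn _ Delta) -[32]/(32%:~R) -intrM ltr_int; lia.
have NR : t.1.1%:~R ^+ 2 + Delta%:R <= reO t.1.2 ^+ 2 + imO t.1.2 ^+ 2.
  rewrite -intr_qnorm N expr2 (pmulrn _ Delta) -!(intrM, intrD) ler_int; nia.
have D1 : 0 <= Delta%:R :> R by [].
have D2 : Delta%:R <= Delta%:R ^+ 2 :> R.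
  by rewrite expr2 -natrM ler_nat; case: (posnP Delta) => [->//|D0]; rewrite leq_pmulr.
have af : t.1.1%:~R * hval t x y <= 0 by rewrite mulr_le0_ge0 ?ltW ?ltrz0.
set a : R := t.1.1%:~R in E aR NR af *.
(* This gives |b|^2 <= 33 |a z + conj b|^2 + 33/32 |a z|^2, hence a^2 + Delta <= 33 Delta + 495/512
   a^2, which contradicts a^2 > 1024 Delta^2. *)
move: NR; have -> : reO t.1.2 ^+ 2 + imO t.1.2 ^+ 2 =
    33 * ((a * x + reO t.1.2) ^+ 2 + (a * y - imO t.1.2) ^+ 2) +
    33 / 32 * (a ^+ 2 * (x ^+ 2 + y ^+ 2)) -
    (a * x + 32 * (a * x + reO t.1.2)) ^+ 2 / 32 -
    (a * y + 32 * (a * y - imO t.1.2)) ^+ 2 / 32 by field.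
have aX : a ^+ 2 * (x ^+ 2 + y ^+ 2) <= a ^+ 2 * (15 / 16) by rewrite ler_wpM2l ?sqr_ge0.
have a2 : (32 * Delta%:R) ^+ 2 < a ^+ 2 by nra.
have := sqr_ge0 (a * x + 32 * (a * x + reO t.1.2)).
have := sqr_ge0 (a * y + 32 * (a * y - imO t.1.2)).
rewrite E; lra.
Qed.

Lemma hterm_gt0 k t x y : odd k -> 0 < hterm k t x y -> 0 < hval t x y.
Proof.
by move=> k1; case: (ltP 0 (hval t x y)) => // f0; rewrite /hterm max_odd_exp_le0 ?ltxx.
Qed.

Lemma hterm_le k t x y : odd k -> forms t -> t.1.1 < 0 -> hterm k t x y <= Delta%:R ^+ k.
Proof.
move=> k1 ft a0; rewrite /hterm ge_max exprn_ge0//=.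
case: (leP (hval t x y) 0) => f0; first by rewrite (@le_trans _ _ 0) ?exprn_odd_le0 ?exprn_ge0.
by rewrite lerXn2r ?nnegrE ?ler0n//; [exact: ltW|exact: hval_le].
Qed.

Definition trunc (n : nat) : pred int := fun a => `|a| <= n%:Z.

(* The sum over [|a| <= n + 1] is bounded by a constant plus [|z|^(2k)] times
   the sum over [|a| <= n] at the inverted point, because inversion turns a form
   with large leading coefficient into one with a smaller leading coefficient. *)
Lemma Hsum_trunc_bounded k : odd k -> exists2 M : R, 0 <= M &
  forall (n : nat) x y, (Hsum (trunc n) k x y <= M%:E)%E.
Proof.
move=> k1.
pose A := 32 * Delta%:Z; pose B := hbox (4 * (2 * Delta%:Z + 2 * A * A) + A).
pose C : R := \sum_(t <- fset_set B) Delta%:R ^+ k.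
have C0 : 0 <= C by apply: sumr_ge0 => t _; rewrite exprn_ge0.
have CE : C%:E = \esum_(t in B) (Delta%:R ^+ k)%:E.
  have fB : finite_set B := finite_hbox _.
  by rewrite esum_fset ?fsbig_finite//= ?sumEFin// => t _; rewrite lee_fin exprn_ge0.
have A0 : 0 <= A by rewrite mulr_ge0.
(* The fixed point of M = C + 15/16 M. *)
exists (16 * C); first by rewrite mulr_ge0.
elim=> [|n IHn] x y.
  rewrite /Hsum esum1 ?lee_fin ?mulr_ge0// => t [_ /andP[a0 aA]].
  by move: aA a0; rewrite /trunc normr_le0 => /eqP ->; rewrite ltxx.
have [l X1] := euclidean x y; rewrite -(HsumD _ k l).
set u := x + _ in X1 *; set v := y + _ in X1 *; clearbody u v => {x y l}.
have X0 : 0 <= u ^+ 2 + v ^+ 2 by rewrite addr_ge0 ?sqr_ge0.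
pose T t := (hterm k t u v)%:E.
have T0 t : (0 <= T t)%E by rewrite lee_fin hterm_ge0.
rewrite -[leLHS]/(esum (nforms (trunc n.+1)) T).
rewrite (@esumID _ _ B _ T (fun t _ => T0 t)).
have le1 : (esum (nforms (trunc n.+1) `&` B) T <= C%:E)%E.
  rewrite CE; apply: le_esum_set => [t _|t []//|t [[ft /andP[a0 _]] _] _].
    by rewrite lee_fin exprn_ge0.
  by rewrite lee_fin hterm_le.
have le2 : (esum (nforms (trunc n.+1) `&` ~` B) T <=
    ((u ^+ 2 + v ^+ 2) ^+ k)%:E *
    Hsum (trunc n) k (u / (u ^+ 2 + v ^+ 2)) (v / (u ^+ 2 + v ^+ 2)))%E.
  rewrite /Hsum -esumZl ?exprn_ge0//; last by move=> t; rewrite lee_fin hterm_ge0.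
  rewrite -[leRHS](@esum_reindex_cancel _ _ _ _
     [set t : form | forms t /\ (t.2 < 0) && trunc n t.2] hswap hswap T) //;
    try exact: hswapK; last first.
  - by move=> t [ft /andP[a0 _]]; rewrite /T hterm_hswap.
  - by move=> t [ft a0]; split=> //; exact: forms_hswap.
  - by move=> t [ft a0]; split=> //; exact: forms_hswap.
  apply: le_esum_set => // t [[ft /andP[a0 an]] tB]; rewrite lte_fin => /hterm_gt0-/(_ k1) f0.
  split=> //.
  (* By [hval_box] a form outside B has |a| > A; then |c| < |a| <= n + 1 yields |c| <= n. *)
  have /andP[-> ca] : (t.2 < 0) && (`|t.2| < `|t.1.1|).
    apply: (hval_far t u v) => //; rewrite ltNge; apply/negP => aA.
    exact/tB/(hval_box t u v).
  by rewrite /= /trunc -ltzD1 addrC -intS; exact: lt_le_trans ca an.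
apply: le_trans (leeD le1 le2) _.
have : (Hsum (trunc n) k (u / (u ^+ 2 + v ^+ 2)) (v / (u ^+ 2 + v ^+ 2))
  <= (16 * C)%:E)%E by exact: IHn.
move=> /(lee_wpmul2l (x := ((u ^+ 2 + v ^+ 2) ^+ k)%:E)).
rewrite lee_fin exprn_ge0// => /(_ isT) le3.
apply: le_trans (leeD (lexx _) le3) _; rewrite -EFinM -EFinD lee_fin.
have Xk : (u ^+ 2 + v ^+ 2) ^+ k <= 15 / 16.
  rewrite (le_trans _ X1)//; case: k k1 {C C0 CE IHn T T0 le1 le2 le3} => // k _.
  by rewrite exprS ler_piMr// exprn_ile1//; lra.
nra.
Qed.

Lemma Hsum_bounded k : odd k -> exists2 M : R, 0 <= M &
  forall x y, (Hsum xpredT k x y <= M%:E)%E.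
Proof.
move=> /Hsum_trunc_bounded[M M0 le_M]; exists M => // x y.
apply: ge_ereal_sup => _ [F [finF FS] <-].
pose n := (\max_(t <- fset_set F) `|t.1.1|%N)%N.
apply: le_trans (le_M n x y); apply: esum_ge; exists F => //; split=> // t Ft.
have [ft /andP[a0 _]] := FS t Ft; split=> //; rewrite a0 /=.
rewrite /trunc -abszE lez_nat /n.
apply: (@leq_bigmax_seq _ _ xpredT (fun t : form => `|t.1.1|%N)) => //.
by rewrite in_fset_set ?mem_set.
Qed.

(** * H as a real function and the relations it imposes on P *)

Definition hfun k x y : R := fine (Hsum xpredT k x y).

Lemma hfunE k x y : odd k -> Hsum xpredT k x y = (hfun k x y)%:E.
Proof.
move=> /Hsum_bounded[M _ HM]; rewrite fineK// ge0_fin_numE.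
  by apply: le_lt_trans (HM x y) _; rewrite ltry.
by apply: esum_ge0 => t _; rewrite lee_fin hterm_ge0.
Qed.

Lemma hfunD k l x y : hfun k (x + reO l) (y + imO l) = hfun k x y.
Proof. by rewrite /hfun HsumD. Qed.

Lemma hfunDz k (n : int) x y : hfun k (x + n%:~R) y = hfun k x y.
Proof. by rewrite -[RHS](hfunD k (n, 0)) /reO /imO /= mulr0z !mul0r !addr0. Qed.

Lemma hfunN k x y : hfun k (- x) (- y) = hfun k x y.
Proof. by rewrite /hfun HsumN. Qed.

Lemma hfun_conj k x y : hfun k x (- y) = hfun k x y.
Proof. by rewrite /hfun Hsum_conj. Qed.

Lemma hfun_bounded k : odd k -> exists M, forall x y, `|hfun k x y| <= M.
Proof.
move=> k1; have [M M0 HM] := Hsum_bounded k k1; exists M => x y.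
rewrite ger0_norm; first by rewrite -lee_fin -hfunE.
by rewrite fine_ge0//; apply: esum_ge0 => t _; rewrite lee_fin hterm_ge0.
Qed.

Lemma hfun_inv k x y : odd k ->
  (x ^+ 2 + y ^+ 2) ^+ k *
    hfun k (x / (x ^+ 2 + y ^+ 2)) (y / (x ^+ 2 + y ^+ 2)) =
  hfun k x y + hper k x y.
Proof.
move=> k1; have := Hsum_inv_fin k x y k1.
rewrite !hfunE// -EFinM -!EFinD => -[E].
have -> : hper k x y = \sum_(t <- fset_set mforms) hterm k t x y -
    \sum_(t <- fset_set mforms) hterm k (hneg t) x y.
  rewrite -sumrB; apply: eq_bigr => t _.
  by rewrite /hterm hval_hneg max_odd_exp.
by rewrite addrA E addrK.
Qed.

(** At z = 0 the factor |z|^(2k) kills one side of [hfun_inv]. This later identifies the coefficient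
    of |z|^(2k) - 1 in P as H(0). *)
Lemma hper0 k : odd k -> hper k 0 0 = - hfun k 0 0.
Proof.
move=> k1; have := hfun_inv k 0 0 k1.
rewrite !expr0n /= addr0 expr0n (gtn_eqF (odd_gt0 k1)) mul0r => /eqP.
by rewrite eq_sym addrC addr_eq0 => /eqP.
Qed.

Lemma hfun_const k : odd k ->
    (forall x y, hper k x y = hfun k 0 0 * ((x ^+ 2 + y ^+ 2) ^+ k - 1)) ->
  forall x y, hfun k x y = hfun k 0 0.
Proof.
move=> k1 perE.
pose g x y := hfun k x y - hfun k 0 0.
pose S := [set r : R | exists x y, r = `|g x y|].
have S0 : S `|g 0 0| by exists 0, 0.
have ubS : has_ubound S.
  have [M HM] := hfun_bounded k k1; exists (M + M) => _ [x [y ->]].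
  by rewrite (le_trans (ler_normB _ _))// lerD.
have gS x y : `|g x y| <= sup S by apply: ub_le_sup => //; exists x, y.
have gS1 x y : `|g x y| <= 15 / 16 * sup S.
  have [l X1] := euclidean x y; rewrite /g -(hfunD k l) -/(g _ _).
  set u := x + _ in X1 *; set v := y + _ in X1 *; clearbody u v => {x y l}.
  have X0 : 0 <= u ^+ 2 + v ^+ 2 by rewrite addr_ge0 ?sqr_ge0.
  have -> : g u v = (u ^+ 2 + v ^+ 2) ^+ k *
      g (u / (u ^+ 2 + v ^+ 2)) (v / (u ^+ 2 + v ^+ 2)).
    by rewrite /g mulrBr hfun_inv// perE; ring.
  rewrite normrM ler_pM// ger0_norm ?exprn_ge0// (le_trans _ X1)//.
  case: k k1 {perE g S S0 ubS gS} => // k _.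
  by rewrite exprS ler_piMr// exprn_ile1//; lra.
have : sup S <= 15 / 16 * sup S by apply: ge_sup => [|_ [x [y ->]]//]; exists `|g 0 0|.
move=> S1 x y; apply/eqP; rewrite -subr_eq0 -normr_le0 (le_trans (gS x y))//.
by have := le_trans (normr_ge0 _) (gS 0 0); lra.
Qed.

(** Analogue of the three-term relation for period polynomials. H agrees at z and 1 - z. Inverting 1
    - z directly, or inverting z, applying w -> 1 - w and inverting again, leads to points with the
    same value of H, so the corrections by P must match. *)
Lemma hper_three_term k (x y : R) : odd k -> x ^+ 2 + y ^+ 2 != 0 ->
    (1 - x) ^+ 2 + y ^+ 2 != 0 ->
  hper k (1 - x) (- y) = hper k x y + (x ^+ 2 + y ^+ 2) ^+ k *
    hper k (1 - x / (x ^+ 2 + y ^+ 2)) (- (y / (x ^+ 2 + y ^+ 2))).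
Proof.
move=> k1 X0 Y0.
have h1 u v : hfun k (1 - u) (- v) = hfun k u v.
  by rewrite addrC -[1]/(1%:~R) hfunDz hfunN.
have E1 := hfun_inv k x y k1.
have E2 := hfun_inv k (1 - x) (- y) k1.
set X := x ^+ 2 + y ^+ 2 in X0 E1 *.
have E3 := hfun_inv k (1 - x / X) (- (y / X)) k1.
rewrite !h1 in E2 E3; rewrite sqrrN in E2.
set Y := (1 - x) ^+ 2 + y ^+ 2 in Y0 E2.
have YE : (1 - x / X) ^+ 2 + (- (y / X)) ^+ 2 = Y / X.
  by rewrite /Y /X; field.
(* The inverse of 1 - z/|z|^2 is the conjugate of 1 - (1 - z)/|1 - z|^2. *)
have E4 : hfun k ((1 - x / X) / (Y / X)) (- (y / X) / (Y / X)) =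
          hfun k ((1 - x) / Y) (- y / Y).
  have -> : (1 - x / X) / (Y / X) = 1 - (1 - x) / Y.
    have -> : 1 - x = Y - X + x by rewrite /X /Y; ring.
    by field; rewrite X0 Y0.
  have -> : - (y / X) / (Y / X) = - (y / Y) by field; rewrite X0 Y0.
  by rewrite mulNr h1 hfun_conj.
rewrite YE E4 in E3.
have E5 : X ^+ k * (Y / X) ^+ k = Y ^+ k by rewrite -exprMn mulrCA divff// mulr1.
have := congr1 ( *%R (X ^+ k)) E3; rewrite /= mulrA E5 E2 mulrDr E1.
by move=> /eqP; rewrite -addrA => /eqP /addrI.
Qed.

(** * The shape of P for k = 1, 3, 5 *)

Definition hflip (t : form) : form := (- t.2, t.1.2, - t.1.1).

(** Averaging over an involution keeps the sum over [mforms] and makes the identities for P hold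
    term by term, where [field] can check them. *)
Definition mavg (h : form -> form) (F : form -> R) (t : form) : R := (F t + F (h t)) / 2.

Lemma msum_reindex (h h' : form -> form) (F : form -> R) :
    (forall t, mforms t -> mforms (h t)) -> (forall t, mforms t -> mforms (h' t)) ->
    cancel h h' -> cancel h' h ->
  \sum_(t <- fset_set mforms) F (h t) = \sum_(t <- fset_set mforms) F t.
Proof.
move=> hm hm' hK h'K; have fm := finite_mforms.
rewrite -!fsbig_finite//; apply/esym/reindex_fsbig.
exact: cancel_set_bij hm hm' hK h'K.
Qed.

Lemma msum_avg (h : form -> form) (F : form -> R) :
    (forall t, mforms t -> mforms (h t)) -> involutive h ->
  \sum_(t <- fset_set mforms) mavg h F t = \sum_(t <- fset_set mforms) F t.
Proof.
move=> hm hK; rewrite -mulr_suml big_split /= (msum_reindex h h)//.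
by field.
Qed.

Lemma hflipK : involutive hflip.
Proof. by case=> [[a b] c]; rewrite /hflip /= !opprK. Qed.

Lemma mforms_hopp t : mforms t -> mforms (hopp t).
Proof. by case=> ft ac; split=> //; exact: forms_hopp. Qed.

Lemma mforms_hconj t : mforms t -> mforms (hconj t).
Proof. by case=> ft ac; split=> //; exact: forms_hconj. Qed.

(** Swapping a and c reverses their signs; negating both restores c < 0 < a. *)
Lemma mforms_hflip t : mforms t -> mforms (hflip t).
Proof.
case=> ft /andP[c0 a0]; split; last by rewrite /= oppr_lt0 oppr_gt0 a0.
by move: ft; rewrite /forms /= => <-; ring.
Qed.

Lemma hper_avg k x y : hper k x y =
  \sum_(t <- fset_set mforms)
    mavg hflip (mavg hopp (mavg hconj (fun t => hval t x y ^+ k))) t.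
Proof.
rewrite !msum_avg//.
- exact: mforms_hconj.
- exact: hconjK.
- exact: mforms_hopp.
- exact: hoppK.
- exact: mforms_hflip.
- exact: hflipK.
Qed.

Lemma hval_hflip t x y : hval (hflip t) x y =
  - t.2%:~R * (x ^+ 2 + y ^+ 2) + 2 * (reO t.1.2 * x - imO t.1.2 * y) - t.1.1%:~R.
Proof. by rewrite /hval /= !rmorphN. Qed.

Lemma hper1E x y : hper 1 x y = hfun 1 0 0 * (x ^+ 2 + y ^+ 2 - 1).
Proof.
pose A := \sum_(t <- fset_set mforms) ((t.1.1%:~R - t.2%:~R) / 2 : R).
have E u v : hper 1 u v = A * (u ^+ 2 + v ^+ 2 - 1).
  rewrite hper_avg mulr_suml; apply: eq_bigr => t _.
  rewrite /mavg !(hval_hconj, hval_hopp, hval_hflip) /hval !expr1.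
  by field.
suff -> : hfun 1 0 0 = A by exact: E.
by apply/eqP; rewrite -eqr_opp -hper0// E; apply/eqP; ring.
Qed.

(** Invariance under z -> -z and conjugation leaves only even powers of x and y; antisymmetry under
    [hflip] produces the factor |z|^2 - 1. *)
Lemma hper3E : exists E1 E2 : R, forall x y, hper 3 x y =
  hfun 3 0 0 * ((x ^+ 2 + y ^+ 2) ^+ 3 - 1) +
  (x ^+ 2 + y ^+ 2 - 1) * (E1 * x ^+ 2 + E2 * y ^+ 2).
Proof.
pose a (t : form) : R := t.1.1%:~R; pose c (t : form) : R := t.2%:~R.
pose A := \sum_(t <- fset_set mforms) ((a t ^+ 3 - c t ^+ 3) / 2).
pose E1 := \sum_(t <- fset_set mforms)
   (3 / 2 * (a t - c t) * (a t * c t + 4 * reO t.1.2 ^+ 2)).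
pose E2 := \sum_(t <- fset_set mforms)
   (3 / 2 * (a t - c t) * (a t * c t + 4 * imO t.1.2 ^+ 2)).
exists E1, E2.
have E u v : hper 3 u v = A * ((u ^+ 2 + v ^+ 2) ^+ 3 - 1) +
  (u ^+ 2 + v ^+ 2 - 1) * (E1 * u ^+ 2 + E2 * v ^+ 2).
  transitivity (A * ((u ^+ 2 + v ^+ 2) ^+ 3 - 1) +
    E1 * ((u ^+ 2 + v ^+ 2 - 1) * u ^+ 2) + E2 * ((u ^+ 2 + v ^+ 2 - 1) * v ^+ 2));
    last by ring.
  rewrite hper_avg !mulr_suml -!big_split /=; apply: eq_bigr => t _.
  rewrite /mavg !(hval_hconj, hval_hopp, hval_hflip) /hval -/(a t) -/(c t).
  by field.
suff -> : hfun 3 0 0 = A by exact: E.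
by apply/eqP; rewrite -eqr_opp -hper0// E; apply/eqP; ring.
Qed.

(* Multiplication of [b] by [omega], a unit when [nu = 1]. *)
Definition hrot (t : form) : form :=
  (t.1.1, (- t.1.2.2, t.1.2.1 + tau * t.1.2.2), t.2).
Definition hrot' (t : form) : form :=
  (t.1.1, (t.1.2.2 + tau * t.1.2.1, - t.1.2.1), t.2).

Lemma hrotK : cancel hrot hrot'.
Proof. by case=> [[a [x y]] c]; rewrite /hrot /hrot' /=; congr (_, (_, _), _); ring. Qed.
Lemma hrot'K : cancel hrot' hrot.
Proof. by case=> [[a [x y]] c]; rewrite /hrot /hrot' /=; congr (_, (_, _), _); ring. Qed.

Lemma mforms_hrot t : nu = 1 -> mforms t -> mforms (hrot t).
Proof.
move=> nu1 [ft ac]; split=> //.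
by move: ft; rewrite /forms /qnorm nu1 /= => <-; ring.
Qed.

Lemma mforms_hrot' t : nu = 1 -> mforms t -> mforms (hrot' t).
Proof.
move=> nu1 [ft ac]; split=> //.
by move: ft; rewrite /forms /qnorm nu1 /= => <-; ring.
Qed.

Lemma hval_hrot t x y : nu = 1 ->
  hval (hrot t) x y = hval t (p * x - q * y) (q * x + p * y).
Proof.
move=> nu1.
(* The two sides differ by an explicit multiple of p^2 + q^2 - 1, which is 0 as [nu] is 1. *)
transitivity (hval t (p * x - q * y) (q * x + p * y) + (p ^+ 2 + q ^+ 2 - 1) *
    (2 * t.1.2.2%:~R * x - t.1.1%:~R * (x ^+ 2 + y ^+ 2))); last first.
  by rewrite qE nu1 subrr mul0r addr0.
by rewrite /hval /reO /imO /= !(rmorphN, rmorphD, rmorphM) /= -pE; ring.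
Qed.

Lemma msum_hrot (F : form -> R) : nu = 1 ->
  \sum_(t <- fset_set mforms) F (hrot t) = \sum_(t <- fset_set mforms) F t.
Proof.
move=> nu1; apply: (msum_reindex hrot hrot'); last exact: hrot'K; last exact: hrotK.
- by move=> t; exact: mforms_hrot.
- by move=> t; exact: mforms_hrot'.
Qed.

Lemma hper_rot k x y : nu = 1 -> hper k (p * x - q * y) (q * x + p * y) = hper k x y.
Proof.
move=> nu1; rewrite /hper -[RHS]msum_hrot//.
by apply: eq_bigr => t _; rewrite hval_hrot.
Qed.

(** In terms of x and q y all coefficients are rational, so the identity in [hper5E] needs no
    relation for q. *)
Lemma hval_eisenstein t (x y : R) : tau = 1 -> nu = 1 ->
  hval t x y = t.1.1%:~R * (x ^+ 2 + 4 / 3 * (q * y) ^+ 2) +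
    t.1.2.1%:~R * (2 * x) + t.1.2.2%:~R * (x - 2 * (q * y)) + t.2%:~R.
Proof.
move=> tau1 nu1; have pE' : p = 2^-1 by have := pE; rewrite tau1; lra.
have q2 : q ^+ 2 = 3 / 4 by have := qE; rewrite nu1 pE'; lra.
by rewrite exprMn q2 /hval /reO /imO pE'; field.
Qed.

(** Averaging over the six units leaves, from the powers of the linear part, only the second and
    fourth, whose averages are polynomials in X = |z|^2; [hflip] then pairs X^j with -X^(5-j). *)
Lemma hper5E : tau = 1 -> nu = 1 -> exists B C : R, forall x y : R,
  let X := x ^+ 2 + y ^+ 2 in
  hper 5 x y = hfun 5 0 0 * (X ^+ 5 - 1) + B * (X ^+ 4 - X) + C * (X ^+ 3 - X ^+ 2).
Proof.
move=> tau1 nu1.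
pose a (t : form) : R := t.1.1%:~R; pose c (t : form) : R := t.2%:~R.
pose m (t : form) : R := t.1.2.1%:~R; pose n (t : form) : R := t.1.2.2%:~R.
pose N t := m t ^+ 2 + m t * n t + n t ^+ 2.
pose A := \sum_(t <- fset_set mforms) ((a t ^+ 5 - c t ^+ 5) / 2).
pose B := \sum_(t <- fset_set mforms)
  (5 / 2 * (a t ^+ 4 * c t + 4 * a t ^+ 3 * N t - a t * c t ^+ 4 - 4 * c t ^+ 3 * N t)).
pose C := \sum_(t <- fset_set mforms)
  (5 * (a t ^+ 3 * c t ^+ 2 + 6 * a t ^+ 2 * c t * N t + 3 * a t * N t ^+ 2 -
        a t ^+ 2 * c t ^+ 3 - 6 * a t * c t ^+ 2 * N t - 3 * c t * N t ^+ 2)).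
exists B, C.
have E (x y : R) : let X := x ^+ 2 + y ^+ 2 in
    hper 5 x y = A * (X ^+ 5 - 1) + B * (X ^+ 4 - X) + C * (X ^+ 3 - X ^+ 2).
  have -> /= : x ^+ 2 + y ^+ 2 = x ^+ 2 + 4 / 3 * (q * y) ^+ 2.
    have := qE; rewrite nu1 (_ : p = 2^-1); last by have := pE; rewrite tau1; lra.
    move=> q2; rewrite exprMn (_ : q ^+ 2 = 3 / 4); last by lra.
    by field.
  pose F0 t := hval t x y ^+ 5.
  pose F t := (F0 t + F0 (hrot t) + F0 (hrot (hrot t))) / 3.
  have -> : hper 5 x y = \sum_(t <- fset_set mforms) F t.
    rewrite -mulr_suml !big_split /= (msum_hrot (fun t => F0 (hrot t)) nu1) (msum_hrot F0 nu1).
    by rewrite -/(hper 5 x y); field.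
  rewrite -(msum_avg hopp F mforms_hopp hoppK) -(msum_avg hflip _ mforms_hflip hflipK).
  rewrite !mulr_suml -!big_split /=; apply: eq_bigr => t _.
  rewrite /mavg /F /F0 !hval_eisenstein// /hrot /hflip /hopp /= tau1 !mul1r.
  rewrite !(mulrNz, intrD) -/(a t) -/(c t) -/(m t) -/(n t) /N.
  by move: (q * y) (a t) (c t) (m t) (n t) => v *; field.
suff -> : hfun 5 0 0 = A by exact: E.
by apply/eqP; rewrite -eqr_opp -hper0// E; apply/eqP; ring.
Qed.

(** * Vanishing of the remaining coefficients *)

Lemma hfun1_const x y : hfun 1 x y = hfun 1 0 0.
Proof. by apply: hfun_const => // u v; rewrite hper1E expr1. Qed.

(** The three-term relation at z = 3 involves only the real points 3, -2 and 2/3, where E2 is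
    absent; H(0) cancels and E1 remains. *)
Lemma hper3_real E1 E2 :
    (forall x y : R, hper 3 x y =
      hfun 3 0 0 * ((x ^+ 2 + y ^+ 2) ^+ 3 - 1) +
      (x ^+ 2 + y ^+ 2 - 1) * (E1 * x ^+ 2 + E2 * y ^+ 2)) ->
  E1 = 0.
Proof.
move=> P3; have X9 : 3 ^+ 2 + 0 ^+ 2 = 9 :> R by ring.
have Y4 : (1 - 3) ^+ 2 + 0 ^+ 2 = 4 :> R by ring.
have := hper_three_term 3 3 0 isT; rewrite X9 Y4 !pnatr_eq0 => /(_ isT isT).
rewrite !P3; lra.
Qed.

Lemma hfun3_const_unit x y : nu = 1 -> hfun 3 x y = hfun 3 0 0.
Proof.
move=> nu1; apply: hfun_const => // {}x {}y.
have [E1 [E2 P3]] := hper3E; have E10 := hper3_real _ _ P3.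
(* P agrees at 2 and at 2 omega; only the latter is off the real axis and sees E2. *)
have := hper_rot 3 2 0 nu1; rewrite !mulr0 subr0 addr0 !P3 E10.
have -> : (p * 2) ^+ 2 + (q * 2) ^+ 2 = 4 by rewrite !exprMn -mulrDl qE nu1; ring.
move=> E; have : q ^+ 2 * E2 = 0 by move: E; rewrite exprMn; lra.
by move=> /eqP; rewrite mulf_eq0 sqrf_eq0 gt_eqF//= => /eqP ->; ring.
Qed.

Lemma hfun5_const x y : tau = 1 -> nu = 1 -> hfun 5 x y = hfun 5 0 0.
Proof.
move=> tau1 nu1; apply: hfun_const => // {}x {}y.
have [B [C P5]] := hper5E tau1 nu1.
(* The three-term relation at 3 and at 2 + i gives two independent equations for B and C. *)
have e1 : 3 * B + C = 0.
  have X9 : 3 ^+ 2 + 0 ^+ 2 = 9 :> R by ring.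
  have Y4 : (1 - 3) ^+ 2 + 0 ^+ 2 = 4 :> R by ring.
  have := hper_three_term 5 3 0 isT; rewrite X9 Y4 !pnatr_eq0 => /(_ isT isT).
  rewrite !P5 /=; lra.
have e2 : 47 * B + 17 * C = 0.
  have X5 : 2 ^+ 2 + 1 ^+ 2 = 5 :> R by ring.
  have Y2 : (1 - 2) ^+ 2 + 1 ^+ 2 = 2 :> R by ring.
  have := hper_three_term 5 2 1 isT; rewrite X5 Y2 !pnatr_eq0 => /(_ isT isT).
  rewrite !P5 /=; lra.
have B0 : B = 0 by lra.
have C0 : C = 0 by lra.
by rewrite P5 B0 C0 /=; ring.
Qed.

Lemma hfun3_const_7 x y : tau = 1 -> nu = 2 -> hfun 3 x y = hfun 3 0 0.
Proof.
move=> tau1 nu2; apply: hfun_const => // {}x {}y.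
have [E1 [E2 P3]] := hper3E; have E10 := hper3_real _ _ P3.
have pE' : p = 2^-1 by have := pE; rewrite tau1; lra.
have q2 : q ^+ 2 = 7 / 4 by have := qE; rewrite nu2 pE'; lra.
(* With imaginary parts measured in units of q = sqrt(7)/2, all points used have rational
   coordinates. [rel] is [hfun_inv] from (u, w), of squared modulus X, to its inverse (u', w'). *)
pose h u w : R := hfun 3 u (w * q).
pose rel (u w X u' w' : R) : Prop := X ^+ 3 * h u' w' =
  h u w + hfun 3 0 0 * (X ^+ 3 - 1) + (X - 1) * (E2 * (w ^+ 2 * (7 / 4))).
have inv (u w X u' w' : R) : u ^+ 2 + w ^+ 2 * (7 / 4) = X -> 0 < X ->
    u' * X = u -> w' * X = w -> rel u w X u' w'.
  move=> XE /lt0r_neq0 X0 uE wE; have := hfun_inv 3 u (w * q) isT.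
  have wq : (w * q) ^+ 2 = w ^+ 2 * (7 / 4) by rewrite exprMn q2.
  have wX : w * q / X = w' * q by rewrite -wE (mulrAC w') mulfK.
  have uX : u / X = u' by rewrite -uE mulfK.
  by rewrite P3 E10 mul0r add0r !wq !XE uX wX addrA /rel.
have shift (u w : R) : h (u - 2^-1) (w - 1) = h u w.
  rewrite /h -[RHS](hfunD 3 (0, - 1)) /reO /imO /= pE' !mulrNz mulr0z add0r mulr1z.
  by rewrite !mulN1r mulrBl mul1r.
have hN (u w : R) : h (- u) (- w) = h u w by rewrite /h mulNr hfunN.
have hC (u w : R) : h u (- w) = h u w by rewrite /h mulNr hfun_conj.
have h0 : h 0 0 = hfun 3 0 0 by rewrite /h mul0r.
have h2 : h 2 0 = h 0 0 by rewrite /h -[2]add0r -[2]/(2%:~R) hfunDz.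
have a1 : h 0 1 = h 2^-1 0 by rewrite -(shift 0 1) sub0r subrr -(hN 2^-1 0) oppr0.
have a3 : h 0 (4 / 7) = h 2^-1 (3 / 7).
  by rewrite -(shift 0) sub0r (_ : 4 / 7 - 1 = - (3 / 7)) ?hN//; field.
have a4 : h (7 / 8) (3 / 4) = h (3 / 8) 4^-1.
  rewrite -shift (_ : 3 / 4 - 1 = - 4^-1) ?hC; last by field.
  by rewrite (_ : 7 / 8 - 2^-1 = 3 / 8); last by field.
have a5 : h (3 / 2) 1 = h 0 0.
  rewrite -shift subrr (_ : 3 / 2 - 2^-1 = 0 + 1%:~R); last by field.
  by rewrite /h hfunDz.
(* Two ways of evaluating H at (7 + 3 sqrt(-7)) / 8, both starting from 0. *)
have i1 : rel 2 0 4 2^-1 0 by apply: inv; lra.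
have i2 : rel 0 1 (7 / 4) 0 (4 / 7) by apply: inv; lra.
have i3 : rel 2^-1 (3 / 7) (4 / 7) (7 / 8) (3 / 4) by apply: inv; lra.
have i4 : rel (3 / 2) 1 4 (3 / 8) 4^-1 by apply: inv; lra.
rewrite /rel h2 ?h0 in i1; rewrite /rel a1 a3 in i2; rewrite /rel a4 in i3.
rewrite /rel a5 h0 in i4.
have E20 : E2 = 0 by lra.
by rewrite P3 E10 E20; ring.
Qed.
End HermitianForms.

(** * Transfer to the complex formulation and the five values of d *)

Lemma intr_complex (R : realType) (n : int) : n%:~R = Complex (n%:~R : R) 0.
Proof. by rewrite -[RHS]/(real_complex R n%:~R) rmorph_int. Qed.

Section Transfer.
Variables (R : realType) (tau nu : int) (p q : R) (d Delta : nat).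
Hypotheses (pE : 2 * p = tau%:~R) (qE : p ^+ 2 + q ^+ 2 = nu%:~R).
Hypothesis omegaE : omega R d = Complex p q.

Lemma embOE b : embO R d b = Complex (reO R p b) (imO R q b).
Proof. by rewrite /embO omegaE !intr_complex /reO /imO; simpc. Qed.

Lemma normC_embO b : normC R (embO R d b) = (qnorm tau nu b)%:~R.
Proof.
rewrite embOE /normC !intr_complex (intr_qnorm _ _ _ _ _ pE qE); simpc.
by congr Complex; ring.
Qed.

Lemma H_Hsum k x y :
  H R d k Delta (Complex x y) = Hsum R tau nu p q Delta xpredT k x y.
Proof.
rewrite /H /Hsum.
have -> : Hindex R d Delta = nforms tau nu Delta xpredT.
  apply/seteqP; split=> -[[a b] c]; rewrite /Hindex /nforms /forms /= normC_embO
    -intrB (pmulrn _ Delta).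
  - by move=> [/eqP]; rewrite eqr_int => /eqP -> ->.
  - by move=> [-> ]; rewrite andbT.
apply: eq_esum => -[[a b] c] _; congr (Num.max 0 (_ ^+ k))%:E.
by rewrite /Qform /= embOE !intr_complex /hval /=; simpc; ring.
Qed.

End Transfer.

Lemma omega_params (R : realType) (d : nat) : d \in [:: 1; 2; 3; 7; 11]%N ->
  exists tau nu : int, exists p q : R,
    [/\ omega R d = Complex p q, 2 * p = tau%:~R & p ^+ 2 + q ^+ 2 = nu%:~R] /\
    [/\ 0 <= p, p <= 2^-1, 0 < q, 3 / 4 <= q ^+ 2 & q ^+ 2 <= 11 / 4] /\
    [/\ d \in [:: 1; 3]%N -> nu = 1, d = 3%N -> tau = 1 & d = 7%N -> tau = 1 /\ nu = 2].
Proof.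
have s2 (n : nat) : Num.sqrt (n%:R : R) ^+ 2 = n%:R by rewrite sqr_sqrtr.
have s0 (n : nat) : (0 < n)%N -> 0 < Num.sqrt (n%:R : R) by rewrite sqrtr_gt0 ltr0n.
have half (n : nat) : (Num.sqrt (n%:R : R) / 2) ^+ 2 = n%:R / 4.
  by rewrite exprMn s2; field.
rewrite !inE => /or4P[/eqP->|/eqP->|/eqP->|/orP[/eqP->|/eqP->]]; rewrite /omega /=.
- exists 0, 1, 0, (Num.sqrt 1%:R); do !split=> //; rewrite ?s2 ?s0//; lra.
- exists 0, 2, 0, (Num.sqrt 2%:R); do !split=> //; rewrite ?s2 ?s0//; lra.
- exists 1, 1, 2^-1, (Num.sqrt 3%:R / 2); do !split=> //; rewrite ?half ?divr_gt0 ?s0//; lra.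
- exists 1, 2, 2^-1, (Num.sqrt 7%:R / 2); do !split=> //; rewrite ?half ?divr_gt0 ?s0//; lra.
- exists 1, 3, 2^-1, (Num.sqrt 11%:R / 2); do !split=> //; rewrite ?half ?divr_gt0 ?s0//; lra.
Qed.

Theorem theorem1p2 (R : realType) (d Delta : nat)
    (hd : d \in [:: 1; 2; 3; 7; 11]%N)
    (hDelta : (0 < Delta)%N)
    (hnorm : forall beta : int * int, normC R (embO R d beta) <> Delta%:R) :
  (forall z : R[i], H R d 1 Delta z = alpha R d 1 Delta) /\
  (d \in [:: 1; 3; 7]%N -> forall z : R[i], H R d 3 Delta z = alpha R d 3 Delta) /\
  (d = 3%N -> forall z : R[i], H R d 5 Delta z = alpha R d 5 Delta).
Proof.
have [tau [nu [p [q [[oE pE qE] [[p0 p1 q0 q2 q3] [d13 d3 d7]]]]]]] := omega_params R d hd.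
have DeltaP b : qnorm tau nu b <> Delta.
  by move=> bD; apply: (hnorm b); rewrite (normC_embO _ _ _ _ _ _ pE qE oE) bD.
have HE k x y : odd k ->
    H R d k Delta (Complex x y) = (hfun R tau nu p q Delta k x y)%:E.
  by move=> k1; rewrite (H_Hsum _ _ _ _ _ _ _ pE qE oE) hfunE.
have conclude k : odd k ->
    (forall x y, hfun R tau nu p q Delta k x y = hfun R tau nu p q Delta k 0 0) ->
    forall z, H R d k Delta z = alpha R d k Delta.
  by move=> k1 hc [x y]; rewrite /alpha -[0]/(Complex 0 0) !HE// hc.
split; first by apply: conclude => // x y; exact: hfun1_const.
split=> [|dE]; last first.
  by apply: conclude => // x y; apply: hfun5_const => //; [exact: d3|apply: d13; rewrite dE].
rewrite !inE => /or3P[/eqP dE|/eqP dE|/eqP dE]; apply: conclude => // x y.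
- by apply: hfun3_const_unit => //; apply: d13; rewrite dE.
- by apply: hfun3_const_unit => //; apply: d13; rewrite dE.
- by have [tau1 nu2] := d7 dE; exact: hfun3_const_7.
Qed.
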